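(* Let $d\ge 2$, let $\mathcal X\in\mathbb R^{n_1\times\cdots\times n_d}$ be a nonzero tensor, and let $B$ be a storage budget such that $\{\mathbf r\in\mathcal R : S(\mathbf r)\le B\}$ is nonempty. Let $\mathbf r^\star$ be a global minimiser of the allocation problem $$\min_{\mathbf r\in\mathcal R} f(\mathbf r)\quad\text{subject to}\quad S(\mathbf r)\le B,$$ and let $\mathcal C\subseteq\{1,\ldots,d\}$ be a set of modes $j$ each satisfying $n_j\ge 2$ and $L_j(n_j-1)^2>\Gamma_j(B)$ (''certified'' modes). Let $\widehat{\mathcal X}$ be a truncated HOSVD or ST-HOSVD approximation of $\mathcal X$ at multilinear rank $\mathbf r^\star$, with relative reconstruction error $$e=\frac{\|\mathcal X-\widehat{\mathcal X}\|_F}{\|\mathcal X\|_F}.$$ For any mode $k\notin\mathcal C$ with $L_k(r_k^\star)>0$, define $$\delta_k=\frac{\sum_{j\notin\mathcal C,\ j\ne k}L_j(r_j^\star)^2}{L_k(r_k^\star)^2}.$$ Then $$L_k(r_k^\star)\le e\le L_k(r_k^\star)\sqrt{1+\delta_k}.$$ In particular, if all modes other than $k$ belong to $\mathcal C$, then $$e^2=f(\mathbf r^\star)=L_k(r_k^\star)^2.$$ The same conclusions hold if $\widehat{\mathcal X}$ is replaced (in the definition of $e$) by the result of a rank-preserving, non-error-increasing refinement initialised from either HOSVD variant.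
   Context: For $\mathcal X\in\mathbb R^{n_1\times\cdots\times n_d}$, the mode-$k$ unfolding $X_{(k)}\in\mathbb R^{n_k\times\prod_{j\ne k}n_j}$ is the matrix obtained by reshaping $\mathcal X$ so that mode $k$ indexes the rows and all remaining modes are collapsed into the columns. The mode-$k$ product $\mathcal X\times_k M$ with $M\in\mathbb R^{m\times n_k}$ is the tensor with $(\mathcal X\times_k M)_{(k)}=M X_{(k)}$. The singular values of $X_{(k)}$ are $\sigma_1(X_{(k)})\ge\cdots\ge\sigma_{n_k}(X_{(k)})\ge 0$ (the square roots of the $n_k$ eigenvalues of $X_{(k)}X_{(k)}^\top$, so padded by zeros if necessary). $\|\cdot\|_F$ is the Frobenius norm. The normalised mode-$k$ tail energy $L_k(r_k)\ge 0$ is defined by $$L_k(r_k)^2=\frac{\sum_{i>r_k}\sigma_i^2(X_{(k)})}{\|\mathcal X\|_F^2}.$$ Rank vectors are $\mathbf r=(r_1,\ldots,r_d)\in\mathcal R:=\prod_{k=1}^d\{1,\ldots,n_k\}$. The objective (tail-energy surrogate) and the Tucker storage function are $$f(\mathbf r)=\sum_{k=1}^d L_k(r_k)^2,\qquad S(\mathbf r)=\prod_{k=1}^d r_k+\sum_{k=1}^d n_k r_k .$$ Put $$\Delta_k(\mathbf r)=n_k+\prod_{j\ne k}r_j,\qquad s(\mathbf r)=B-S(\mathbf r).$$ An allocation $\mathbf r\in\mathcal R$ with $r_k<n_k$ is called $k$-tight if $0\le s(\mathbf r)<\Delta_k(\mathbf r)$. For a $k$-tight $\mathbf r$ and a mode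 $m\ne k$ define $$p_{k,m}(\mathbf r)=\left\lceil\frac{\Delta_k(\mathbf r)-s(\mathbf r)}{n_m+(r_k+1)\prod_{j\ne k,m}r_j}\right\rceil,$$ $$c_{k,m}(\mathbf r)=\frac{1}{\|\mathcal X\|_F^2}\sum_{i=r_m-p_{k,m}(\mathbf r)+1}^{r_m}\sigma_i^2(X_{(m)})\quad\text{if }p_{k,m}(\mathbf r)<r_m,$$ and $c_{k,m}(\mathbf r)=\infty$ if $p_{k,m}(\mathbf r)\ge r_m$. Finally $$\Gamma_k(B)=\max_{\substack{\mathbf r\in\mathcal R,\ S(\mathbf r)\le B\\ r_k<n_k,\ 0\le s(\mathbf r)<\Delta_k(\mathbf r)}}\ \min_{m\ne k}c_{k,m}(\mathbf r)\in[0,\infty],$$ with $\Gamma_k(B)=0$ if the maximisation set is empty. Truncated HOSVD at multilinear rank $\mathbf r$: for each $k$ let $U^{(k)}\in\mathbb R^{n_k\times r_k}$ have as columns orthonormal leading $r_k$ left singular vectors of $X_{(k)}$; then $\widehat{\mathcal X}=\mathcal X\times_1 U^{(1)}U^{(1)\top}\times_2\cdots\times_d U^{(d)}U^{(d)\top}$. ST-HOSVD (sequentially truncated HOSVD) at multilinear rank $\mathbf r$: process the modes one after another in some fixed order, starting from $\mathcal G=\mathcal X$; when mode $k$ is processed, let $U^{(k)}\in\mathbb R^{n_k\times r_k}$ have as columns orthonormal leading $r_k$ left singular vectors of the mode-$k$ unfolding of the current $\mathcal G$, and replace $\mathcal G$ by $\mathcal G\times_k U^{(k)\top}$; at the end $\widehat{\mathcal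 X}=\mathcal G\times_1U^{(1)}\times_2\cdots\times_dU^{(d)}$. A rank-preserving, non-error-increasing refinement of such an $\widehat{\mathcal X}$ (for example, HOOI, the higher-order orthogonal iteration) produces a tensor $\widetilde{\mathcal X}$ that is again a Tucker approximation at multilinear rank $\mathbf r^\star$ (so each mode-$j$ unfolding of $\widetilde{\mathcal X}$ has rank at most $r_j^\star$) and satisfies $\|\mathcal X-\widetilde{\mathcal X}\|_F\le\|\mathcal X-\widehat{\mathcal X}\|_F$. *)

(* Defs.v *)
From HB Require Import structures.
From mathcomp Require Import all_boot all_order all_algebra.
From mathcomp Require Import all_classical all_reals.

Set Implicit Arguments.
Unset Strict Implicit.
Unset Printing Implicit Defensive.

Import Order.TTheory GRing.Theory Num.Theory.

Local Open Scope ring_scope.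

(* Conventions.  Modes are 'I_d and all indices are 0-based, so sing_val A i is
   sigma_(i+1)(A).  A dimension vector or a rank vector is a function
   'I_d -> nat. *)

Section Tensor.
Variable d : nat.
Implicit Types (n m q r : 'I_d -> nat) (k : 'I_d) (s : seq 'I_d).

Definition midx n := {dffun forall j : 'I_d, 'I_(n j)}.

(* The indices of the columns of the mode-k unfolding: one index for each mode
   other than k. *)
Definition cidx n k := {dffun forall j : {j : 'I_d | j != k}, 'I_(n (val j))}.

Lemma neq_bool (j k : 'I_d) : j <> k -> j != k.
Proof. by move/eqP. Qed.

Definition insert_idx n k (i : 'I_(n k)) (c : cidx n k) : midx n :=
  [ffun j => match j =P k with
             | ReflectT e => cast_ord (esym (congr1 n e)) i
             | ReflectF ne => c (exist _ j (neq_bool ne))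
             end].

Definition upd n k (p : nat) : 'I_d -> nat :=
  fun j => if j == k then p else n j.

Lemma upd_same n k p : upd n k p k = p.
Proof. by rewrite /upd eqxx. Qed.

Lemma upd_other n k p j : j != k -> upd n k p j = n j.
Proof. by rewrite /upd => /negbTE->. Qed.

Definition remove_idx n k p (i : midx (upd n k p)) : cidx n k :=
  [ffun j => cast_ord (upd_other n p (valP j)) (i (val j))].

Variable R : realType.

Definition tensor n := {ffun midx n -> R}.

Definition frobenius n (X : tensor n) : R := Num.sqrt (\sum_i X i ^+ 2).

Definition rel_error n (X Y : tensor n) : R := frobenius (X - Y) / frobenius X.

Definition unfold n k (X : tensor n) : 'M[R]_(n k, #|{: cidx n k}|) :=
  \matrix_(i, c) X (insert_idx i (enum_val c)).

(* The tensor whose mode-k unfolding is M *m unfold k X. *)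
Definition mode_prod n k p (M : 'M[R]_(p, n k)) (X : tensor n) :
    tensor (upd n k p) :=
  [ffun i : midx (upd n k p) => (M *m unfold k X) (cast_ord (upd_same n k p) (i k))
                               (enum_rank (remove_idx i))].

(* Transport between dimension vectors that are pointwise equal but not
   convertible; only used in that case (see retype_id). *)
Definition retype n m (X : tensor n) : tensor m :=
  [ffun i : midx m => \sum_(a : midx n | [forall j, val (a j) == val (i j)]) X a].

Lemma retype_id n (X : tensor n) : retype n X = X.
Proof.
apply/ffunP=> i; rewrite ffunE (big_pred1 i) // => a.
apply/forallP/eqP => [h|->//].
by apply/ffunP=> j; apply/val_inj/eqP/h.
Qed.

(* Y x_(s1) M_(s1) x_(s2) M_(s2) ... along the modes s1, s2, ... of s, where Y
   is the current tensor.  For s without repetition, q and n agree on the modes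
   still to be processed, so that conform_mx is then a mere type cast. *)
Fixpoint mode_prods_seq n m (M : forall k, 'M[R]_(m k, n k)) s q
    (Y : tensor q) : tensor m :=
  match s with
  | [::] => retype m Y
  | k :: s' =>
      mode_prods_seq M s' (mode_prod (p := m k) (k := k) (conform_mx 0 (M k)) Y)
  end.

(* X x_1 M_1 x_2 ... x_d M_d *)
Definition mode_prods n m (M : forall k, 'M[R]_(m k, n k)) (X : tensor n) :
    tensor m :=
  mode_prods_seq M (enum 'I_d) X.

(* The eigenvalues of a real symmetric matrix, repeated according to
   multiplicity, in nonincreasing order: by the spectral theorem the set below
   is then a singleton, and the default value is not used. *)
Definition eigvals p (A : 'M[R]_p) : seq R :=
  xget (nseq p 0) [set e : seq R | sorted >=%R e /\
                    char_poly A = \prod_(x <- e) ('X - x%:P)]%classic.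

Definition sing_val (p q : nat) (A : 'M[R]_(p, q)) (i : nat) : R :=
  Num.sqrt (eigvals (A *m A^T))`_i.

(* Left singular vectors are taken as eigenvectors of A A^T, consistently with
   the definition of the (zero-padded) singular values. *)
Definition leading_left_svecs (p q t : nat) (A : 'M[R]_(p, q))
    (U : 'M[R]_(p, t)) : Prop :=
  U^T *m U = 1%:M /\
  forall i : 'I_t, A *m A^T *m col i U = sing_val A i ^+ 2 *: col i U.

Definition is_hosvd n r (X Y : tensor n) : Prop :=
  exists U : forall k, 'M[R]_(n k, r k),
    (forall k, leading_left_svecs (unfold k X) (U k)) /\
    Y = mode_prods (fun k => U k *m (U k)^T) X.

(* Starting from the current core H and processing the modes of s in order, the
   final core is G.  As above, conform_mx and retype are mere type casts. *)
Fixpoint st_core n r (U : forall k, 'M[R]_(n k, r k)) s q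
    (H : tensor q) (G : tensor r) : Prop :=
  match s with
  | [::] => G = retype r H
  | k :: s' =>
      let V : 'M[R]_(q k, r k) := conform_mx 0 (U k) in
      leading_left_svecs (unfold k H) V /\
      st_core U s' (mode_prod (k := k) V^T H) G
  end.

Definition is_sthosvd n r (X Y : tensor n) : Prop :=
  exists (s : seq 'I_d) (U : forall k, 'M[R]_(n k, r k)) (G : tensor r),
    [/\ perm_eq s (enum 'I_d), st_core U s X G & Y = mode_prods U G].

Definition is_tucker n r (Y : tensor n) : Prop :=
  exists (G : tensor r) (U : forall k, 'M[R]_(n k, r k)), Y = mode_prods U G.

Definition is_refinement n r (X Xhat Y : tensor n) : Prop :=
  is_tucker r Y /\ frobenius (X - Y) <= frobenius (X - Xhat).

Definition tail_energy n (X : tensor n) k (t : nat) : R :=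
  Num.sqrt ((\sum_(t <= i < n k) sing_val (unfold k X) i ^+ 2) / frobenius X ^+ 2).

Definition rank_vector n r : Prop := forall k, (1 <= r k <= n k)%N.

Definition surrogate n (X : tensor n) r : R :=
  \sum_k tail_energy X k (r k) ^+ 2.

Definition storage n r : nat := (\prod_k r k + \sum_k n k * r k)%N.

Definition is_minimiser n (X : tensor n) (B : R) r : Prop :=
  [/\ rank_vector n r, (storage n r)%:R <= B &
      forall r', rank_vector n r' -> (storage n r')%:R <= B ->
        surrogate X r <= surrogate X r'].

Definition increment n k r : nat := (n k + \prod_(j | j != k) r j)%N.

Definition slack n (B : R) r : R := B - (storage n r)%:R.

Definition tight n (B : R) k r : bool :=
  (r k < n k)%N && (0 <= slack n B r < (increment n k r)%:R).

(* The ceiling is positive when r is k-tight, so the absolute value is only the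
   passage from int to nat. *)
Definition decrement n (B : R) k (m : 'I_d) r : nat :=
  `|Num.ceil (((increment n k r)%:R - slack n B r) /
      (n m + (r k).+1 * \prod_(j | (j != k) && (j != m)) r j)%:R)|%N.

Definition decrement_cost n (X : tensor n) (B : R) k (m : 'I_d) r : \bar R :=
  let p := decrement n B k m r in
  if (p < r m)%N then
    ((\sum_(r m - p <= i < r m) sing_val (unfold m X) i ^+ 2)
      / frobenius X ^+ 2)%:E
  else +oo%E.

(* The costs are nonnegative, so 0 is neutral for the maximum. *)
Definition Gamma n (X : tensor n) (B : R) k : \bar R :=
  \big[Order.max/0%E]_(r : {dffun forall j : 'I_d, 'I_(n j).+1} |
      [&& [forall j, (1 <= r j)%N], (storage n (fun j => r j))%:R <= B
        & tight n B k (fun j => r j)])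
    \big[Order.min/+oo%E]_(m : 'I_d | m != k)
      decrement_cost X B k m (fun j => r j).

Definition certified n (X : tensor n) (B : R) k : Prop :=
  (2 <= n k)%N /\ (Gamma X B k < (tail_energy X k (n k).-1 ^+ 2)%:E)%E.

End Tensor.

(* Main.v *)
(* A certified mode j is not truncated by an optimal allocation: otherwise its
   rank could be raised by one, the storage being paid for, if necessary, by
   lowering the rank of another mode at a cost of at most Gamma, and the
   surrogate would decrease.  Hence only the uncertified modes contribute to the
   surrogate.  The error is bounded below by Eckart-Young in mode k and above by
   the classical estimate f(r) for HOSVD and ST-HOSVD, both of which rest on Ky
   Fan's trace inequality.

   For the error bounds every tensor is extended by zero to a cube of side N.
   Mode products then become commuting operators on one Euclidean space, with
   orthogonal projections U U^T for the truncations. *)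
Require Import Defs.
From mathcomp Require Import all_boot all_order all_algebra.
From mathcomp Require Import all_classical all_reals.
From mathcomp Require Import perm complex zify ring lra.
Import Order.TTheory GRing.Theory Num.Theory.
Local Open Scope ring_scope.

Set Implicit Arguments.
Unset Strict Implicit.
Unset Printing Implicit Defensive.

(** * Spectral theorem for real symmetric matrices *)

Lemma dot_row_gt0 (R : realDomainType) p (v : 'rV[R]_p) :
  v != 0 -> 0 < (v *m v^T) 0 0.
Proof.
move=> /rV0Pn[i vi0]; rewrite mxE (bigD1 i) //= ltr_pwDl //.
  by rewrite mxE -expr2 exprn_even_gt0.
by apply: sumr_ge0 => j _; rewrite mxE -expr2 sqr_ge0.
Qed.

(** Over the complex numbers an eigenvalue [a] exists, with eigenvector [v]. The matrix is
    Hermitian, so with [w] the conjugate transpose of [v] both [v S w] and [v w] are self-conjugate;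
    as [v w] is nonzero, [a] is real. *)
Lemma symmetric_root (R : rcfType) p (S : 'M[R]_p.+1) :
  S^T = S -> exists a, root (char_poly S) a.
Proof.
move=> symS; pose f := real_complex R.
have [a /eigenvalueP[v vS v0]] : exists a, eigenvalue (map_mx f S) a.
  exact: eigenvalue_closed.
pose w : 'cV_p.+1 := map_mx Num.conj v^T.
have cS : map_mx Num.conj (map_mx f S)^T = map_mx f S.
  apply/matrixP=> i j; rewrite !mxE -{1}symS mxE.
  by apply/CrealP; rewrite complex_real.
have cw : map_mx Num.conj w^T = v.
  by apply/matrixP=> i j; rewrite !mxE conjCK.
have vw : (v *m w) 0 0 != 0.
  have /rV0Pn[i vi0] := v0; rewrite mxE (bigD1 i) //= lt0r_neq0 // ltr_pwDl //.
    by rewrite !mxE mul_conjC_gt0.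
  by apply: sumr_ge0 => j _; rewrite !mxE mul_conjC_ge0.
have conj_mx11 (x : 'M[R[i]]_1) : map_mx Num.conj x^T = (Num.conj (x 0 0))%:M.
  by apply/matrixP=> i j; rewrite !ord1 !mxE.
have E : map_mx Num.conj (v *m map_mx f S *m w)^T = v *m map_mx f S *m w.
  by rewrite !trmx_mul !map_mxM /= cw cS -mulmxA.
have aR : a \is Num.real.
  apply/CrealP; apply: (mulIf vw).
  move: E; rewrite vS -scalemxAl conj_mx11 => /matrixP/(_ 0 0).
  rewrite !mxE eqxx mulr1n rmorphM /= => <-; congr (_ * _).
  have : map_mx Num.conj (v *m w)^T = v *m w.
    by rewrite trmx_mul map_mxM /= cw.
  by rewrite conj_mx11 => /matrixP/(_ 0 0); rewrite !mxE eqxx mulr1n => ->.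
exists (complex.Re a); rewrite -(fmorph_root f) map_char_poly.
rewrite -eigenvalue_root_char; apply/eigenvalueP; exists v => //.
by rewrite vS /f /= RRe_real.
Qed.

Lemma symmetric_eigenvector (R : rcfType) p (S : 'M[R]_p.+1) :
  S^T = S -> exists (a : R) (v : 'rV_p.+1), v *m v^T = 1%:M /\ v *m S = a *: v.
Proof.
move=> /symmetric_root[a]; rewrite -eigenvalue_root_char.
move=> /eigenvalueP[v vS /dot_row_gt0 v0].
pose c := (Num.sqrt ((v *m v^T) 0 0))^-1.
exists a, (c *: v); split; last by rewrite -scalemxAl vS !scalerA mulrC.
rewrite linearZ /= -scalemxAl -scalemxAr scalerA.
apply/matrixP=> i j; rewrite !ord1 mxE [RHS]mxE eqxx.
by rewrite -expr2 /c exprVn sqr_sqrtr ?ltW // mulVf ?gt_eqF.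
Qed.

(* The Householder reflection exchanging the unit vectors v and e_0. *)
Lemma orthogonal_completion (R : realFieldType) p (v : 'rV[R]_p.+1) :
  v *m v^T = 1%:M ->
  exists H : 'M[R]_p.+1, H *m H^T = 1%:M /\ row 0 H = v.
Proof.
move=> v1; pose e : 'rV[R]_p.+1 := delta_mx 0 0.
have [->|ve] := eqVneq v e.
  exists 1%:M; split; first by rewrite trmx1 mulmx1.
  by rewrite row1.
pose w := v - e; have w0 : w != 0 by rewrite subr_eq0.
have := dot_row_gt0 w0; set g := (_ *m _) 0 0 => g0.
have wwg : w *m w^T = g%:M by rewrite [LHS]mx11_scalar.
pose H := 1%:M - (2 / g) *: (w^T *m w).
have HT : H^T = H by rewrite /H linearB linearZ /= trmx1 trmx_mul trmxK.
exists H; split.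
  rewrite HT /H mulmxBr mulmx1 -scalemxAr mulmxBl mul1mx -scalemxAl.
  have -> : w^T *m w *m (w^T *m w) = g *: (w^T *m w).
    by rewrite mulmxA -(mulmxA w^T) wwg mul_mx_scalar scalemxAl.
  rewrite scalerA divfK ?gt_eqF // scaler_nat mulr2n opprD addNKr.
  by rewrite scalerN opprK subrK.
have ee : e *m e^T = 1%:M.
  apply/matrixP=> i j; rewrite !ord1 trmx_delta mul_delta_mx.
  by rewrite !mxE.
have ve_sym : v *m e^T = e *m v^T.
  by rewrite -[LHS]trmxK trmx_mul trmxK; apply/matrixP=> i j; rewrite !ord1 mxE.
pose t : R := (e *m v^T) 0 0.
have etE : e *m v^T = t%:M by rewrite [LHS]mx11_scalar.
(* For unit vectors [v] and [e] the squared length [g] of [w] is [2 - 2 * t], so the reflection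
   moves [e] by exactly [w]. *)
have gE : (2 / g) * (t - 1) = - 1.
  have -> : t - 1 = - (g / 2).
    have := wwg; rewrite /w linearB /= mulmxBl !mulmxBr v1 ee ve_sym etE.
    move=> /matrixP/(_ 0 0); rewrite !mxE eqxx !mulr1n => <-.
    by field.
  by rewrite mulrN mulrA divfK ?gt_eqF // divff ?pnatr_eq0.
rewrite rowE /H mulmxBr mulmx1 -scalemxAr mulmxA.
have -> : e *m w^T = (t - 1)%:M.
  by rewrite linearB /= mulmxBr ee etE -raddfB.
by rewrite mul_scalar_mx scalerA gE scaleN1r opprK addrC subrK.
Qed.

(** Deflation: an orthogonal [H] whose first row is a unit eigenvector turns [S] into [T] with first
    row [(a, 0)]. By symmetry [T] is block diagonal, and induction diagonalises the remaining
    block. *)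
Lemma symmetric_spectral (R : rcfType) p (S : 'M[R]_p) : S^T = S ->
  exists (E : 'M[R]_p) (D : 'rV[R]_p),
    E^T *m E = 1%:M /\ S = E *m diag_mx D *m E^T.
Proof.
elim: p S => [|p IH] S symS.
  exists 1%:M, 0; split; first by rewrite trmx1 mulmx1.
  by apply/matrixP=> -[].
have [a [v [v1 vS]]] := symmetric_eigenvector symS.
have [H [HH H0]] := orthogonal_completion v1.
pose T : 'M[R]_(1 + p) := H *m S *m H^T.
have HtH : H^T *m H = 1%:M by apply: mulmx1C.
have symT : T^T = T by rewrite /T !trmx_mul trmxK symS mulmxA.
have ulT : usubmx T = row_mx a%:M 0.
  have -> : usubmx T = row 0 T.
    apply/matrixP=> i j; rewrite [LHS]mxE [RHS]mxE.
    have -> : lshift p i = 0 by apply/val_inj; rewrite ord1.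
    by [].
  rewrite /T !row_mul H0 vS -scalemxAl -H0 -row_mul HH row1.
  apply/rowP=> j; rewrite mxE [X in a * X]mxE eqxx -(splitK j).
  case: (fintype.split j) => l /=.
    by rewrite row_mxEl mxE !ord1 mulr1n mulr1.
  by rewrite row_mxEr mxE mulr0.
have symD : (drsubmx T)^T = drsubmx T by rewrite trmx_drsub symT.
have [E [D [E1 DE]]] := IH _ symD.
pose F : 'M[R]_(1 + p) := block_mx 1%:M 0 0 E.
pose D' : 'rV[R]_(1 + p) := row_mx (const_mx a) D.
have FF : F^T *m F = 1%:M.
  rewrite /F tr_block_mx trmx1 !trmx0 mulmx_block !mulmx0 !mul0mx !mulmx1.
  by rewrite E1 !addr0 add0r -scalar_mx_block.
have TE : T = F *m diag_mx D' *m F^T.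
  rewrite /F /D' tr_block_mx trmx1 !trmx0 diag_mx_row diag_const_mx.
  rewrite !mulmx_block.
  rewrite !mulmx0 !mul0mx !mulmx1 !mul1mx !addr0 !add0r -DE -[LHS]submxK.
  congr block_mx.
  - by rewrite /ulsubmx ulT row_mxKl.
  - by rewrite /ursubmx ulT row_mxKr mul0mx.
  - by rewrite -[LHS]trmxK trmx_dlsub symT /ursubmx ulT row_mxKr trmx0.
exists (H^T *m (F : 'M_p.+1)), D'; split.
  rewrite trmx_mul trmxK mulmxA -(mulmxA _ H) HH mulmx1; exact: FF.
have -> : S = H^T *m T *m H.
  by rewrite /T !mulmxA HtH mul1mx -mulmxA HtH mulmx1.
by rewrite TE trmx_mul trmxK !mulmxA.
Qed.

(** * Eigenvalues of Gram matrices and singular values *)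

Section SingularValues.
Variables (R : realType) (p q : nat).
Implicit Types (A : 'M[R]_(p, q)).

Lemma char_poly_orthogonal_diag (E : 'M[R]_p) D : E^T *m E = 1%:M ->
  char_poly (E *m diag_mx D *m E^T) = \prod_(i < p) ('X - (D 0 i)%:P).
Proof.
move=> EE; have EE' : E *m E^T = 1%:M by apply: mulmx1C.
have CE : char_poly_mx (E *m diag_mx D *m E^T) =
    map_mx polyC E *m char_poly_mx (diag_mx D) *m map_mx polyC E^T.
  rewrite /char_poly_mx mulmxBr mulmxBl !map_mxM /=; congr (_ - _).
  by rewrite scalar_mxC -mulmxA -map_mxM /= EE' map_mx1 mulmx1.
rewrite /char_poly CE !det_mulmx mulrAC -det_mulmx -map_mxM
  EE' map_mx1 det1 mul1r.
have := char_poly_trig (diag_mx_is_trig D); rewrite /char_poly => ->.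
by apply: eq_bigr => i _; rewrite !mxE eqxx mulr1n.
Qed.

Lemma gram_diag (A : 'M[R]_(p, q)) i : (A *m A^T) i i = \sum_j A i j ^+ 2.
Proof. by rewrite mxE; apply: eq_bigr => j _; rewrite mxE expr2. Qed.

Lemma symmetric_eigvals (S : 'M[R]_p) : S^T = S ->
  sorted >=%R (eigvals S) /\
  exists E : 'M[R]_p,
    E^T *m E = 1%:M /\ S = E *m diag_mx (\row_i (eigvals S)`_i) *m E^T.
Proof.
move=> /symmetric_spectral[E [D [EE SE]]].
pose t := [tuple D 0 i | i < p].
have cS : char_poly S = \prod_(x <- t) ('X - x%:P).
  rewrite SE char_poly_orthogonal_diag // big_tuple.
  by apply: eq_bigr => i _; rewrite tnth_mktuple.
(* The sorted diagonal of a spectral decomposition lies in the set, so [xget] does not fall back on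
   its default. *)
have [] : [set e : seq R | sorted >=%R e /\
    char_poly S = \prod_(x <- e) ('X - x%:P)]%classic (eigvals S).
  apply: xgetPex; exists (sort >=%R t); split.
    by apply: sort_sorted => x y; apply: le_total.
  by rewrite cS; apply/perm_big; rewrite perm_sym perm_sort.
(* By unique factorisation the list of eigenvalues is a permutation of the diagonal; the columns of
   [E] are permuted accordingly. *)
move=> sorted_e; rewrite cS => /esym/prod_XsubC_eq/tuple_permP[s eE].
split=> //; exists (col_perm s E).
have eD (i : 'I_p) : (eigvals S)`_i = D 0 (s i).
  by rewrite eE (nth_map i) ?size_enum_ord // nth_ord_enum tnth_mktuple.
split.
  apply/matrixP=> i j; rewrite mxE.
  transitivity ((E^T *m E) (s i) (s j)).
    by rewrite mxE; apply: eq_bigr => l _; rewrite !mxE.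
  by rewrite EE !mxE (inj_eq perm_inj).
rewrite {1}SE; apply/matrixP=> i j; rewrite !mul_mx_diag !mxE.
rewrite (reindex_inj (@perm_inj _ s)) /=.
by apply: eq_bigr => l _; rewrite !mxE eD.
Qed.

Lemma gram_sym (A : 'M[R]_(p, q)) : (A *m A^T)^T = A *m A^T.
Proof. by rewrite trmx_mul trmxK. Qed.

(** The eigenvalues of a Gram matrix are squared row norms of [E^T *m A], hence nonnegative, so
    squaring [sing_val] undoes its square root. *)
Lemma gram_spectral A : exists E : 'M[R]_p,
  E^T *m E = 1%:M /\
  A *m A^T = E *m diag_mx (\row_i sing_val A i ^+ 2) *m E^T.
Proof.
have [_ [E [EE AE]]] := symmetric_eigvals (gram_sym A).
exists E; split=> //; rewrite {1}AE; congr (_ *m diag_mx _ *m _).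
apply/rowP=> i; rewrite !mxE sqr_sqrtr //.
set D := \row_i _ in AE.
have DE : diag_mx D = (E^T *m A) *m (E^T *m A)^T.
  rewrite trmx_mul trmxK mulmxA -(mulmxA _ A) AE.
  by rewrite !mulmxA EE mul1mx -mulmxA EE mulmx1.
have -> : (eigvals (A *m A^T))`_i = \sum_j (E^T *m A) i j ^+ 2.
  by rewrite -gram_diag -DE !mxE eqxx.
by apply: sumr_ge0 => j _; rewrite sqr_ge0.
Qed.

Lemma sing_val_ge0 A i : 0 <= sing_val A i.
Proof. exact: sqrtr_ge0. Qed.

Lemma sing_val_le A i j : (i <= j)%N -> sing_val A j <= sing_val A i.
Proof.
move=> ij; have [sj|sj] := leqP (size (eigvals (A *m A^T))) j.
  by rewrite {1}/sing_val nth_default // sqrtr0 sing_val_ge0.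
apply: ler_wsqrtr; have [se _] := symmetric_eigvals (gram_sym A).
have ge_trans : transitive (>=%R : rel R).
  by move=> x y z yx zy; apply: le_trans zy yx.
have si := leq_ltn_trans ij sj.
exact: (sorted_leq_nth ge_trans (fun x => lexx x) 0 se) si sj ij.
Qed.

Lemma sing_val_sq_le A i j :
  (i <= j)%N -> sing_val A j ^+ 2 <= sing_val A i ^+ 2.
Proof. by move=> ij; rewrite lerXn2r ?nnegrE ?sing_val_ge0 ?sing_val_le. Qed.

End SingularValues.

(** * Orthogonal projections and Ky Fan's trace inequality *)

Section LowRank.
Variables (R : realType) (p q : nat) (A : 'M[R]_(p, q)).

(** For an unfolding, this is the squared tail energy before normalisation by the tensor norm. *)
Definition sq_tail t : R := \sum_(t <= i < p) sing_val A i ^+ 2.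

Lemma gram_trace : \tr (A *m A^T) = sq_tail 0.
Proof.
have [E [EE ->]] := gram_spectral A.
rewrite mxtrace_mulC mulmxA EE mul1mx mxtrace_diag /sq_tail big_mkord.
by apply: eq_bigr => i _; rewrite mxE.
Qed.

Definition orthoproj n (P : 'M[R]_n) := P^T = P /\ P *m P = P.

Lemma orthoproj_frame n t (U : 'M[R]_(n, t)) :
  U^T *m U = 1%:M -> orthoproj (U *m U^T) /\ \tr (U *m U^T) = t%:R.
Proof.
move=> UU; split; last by rewrite mxtrace_mulC UU mxtrace1.
split; first by rewrite trmx_mul trmxK.
by rewrite mulmxA -(mulmxA U) UU mulmx1.
Qed.

(** The projection onto the column space of [U], written through a basis [V] of that space as
    [V^T (V V^T)^-1 V]; its trace is the rank. The factors of a general Tucker tensor need not be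
    orthonormal, so [U *m U^T] would not do. *)
Lemma orthoproj_range n t (U : 'M[R]_(n, t)) :
  exists P, [/\ orthoproj P, \tr P <= t%:R & P *m U = U].
Proof.
pose V := row_base U^T.
have Vfree : row_free V by rewrite row_base_free.
have [W UW] : exists W, U^T = W *m V by apply/submxP; rewrite eq_row_base.
clearbody V.
(* A row killed by the Gram matrix gives a combination of the rows of [V] of norm zero, against
   their independence. *)
have Gunit : V *m V^T \in unitmx.
  rewrite -row_free_unit -kermx_eq0; apply/rowV0P => u /sub_kermxP uG.
  have uV : u *m V = 0.
    apply/eqP; apply: contraT => /dot_row_gt0.
    by rewrite trmx_mul mulmxA -(mulmxA u) uG mul0mx mxE ltxx.
  by apply: (row_free_inj Vfree); rewrite uV mul0mx.
pose G := invmx (V *m V^T).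
have GT : G^T = G by rewrite /G trmx_inv trmx_mul trmxK.
have VVG : V *m V^T *m G = 1%:M by rewrite mulmxV.
exists (V^T *m G *m V); split.
- split; first by rewrite !trmx_mul trmxK GT mulmxA.
  by rewrite -!mulmxA (mulmxA V) (mulmxA _ G V) VVG mul1mx.
- rewrite -mulmxA mxtrace_mulC -mulmxA mxtrace_mulC VVG mxtrace1 ler_nat.
  by rewrite mxrank_tr rank_leq_col.
- have UE : U = V^T *m W^T by apply: trmx_inj; rewrite trmx_mul !trmxK.
  have : V^T *m G *m V *m (V^T *m W^T) = V^T *m W^T.
    by rewrite -!mulmxA (mulmxA V) (mulmxA G) (mulmx1C VVG) mul1mx.
  by rewrite -UE.
Qed.

(** Symmetry and idempotence make [P i i] the squared norm of row [i], which is at least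
    [P i i ^+ 2]. *)
Lemma orthoproj_diag n (P : 'M[R]_n) i : orthoproj P -> 0 <= P i i <= 1.
Proof.
move=> [PT PP]; have Pi : P i i = \sum_j P i j ^+ 2.
  by rewrite -{1}PP -{2}PT gram_diag.
have Pi0 : 0 <= P i i by rewrite Pi sumr_ge0 // => j _; apply: sqr_ge0.
rewrite Pi0 /= leNgt; apply/negP => P1.
suff : P i i ^+ 2 <= P i i.
  by rewrite expr2 ger_pMr ?(lt_trans ltr01) // leNgt P1.
rewrite {2}Pi (bigD1 i) //= lerDl.
by apply: sumr_ge0 => j _; apply: sqr_ge0.
Qed.

(** In an eigenbasis the trace is a sum of squared singular values with weights [w i] in [0, 1] of
    total at most [t]; it is largest when the weight sits on the first [t] of them. *)
Lemma ky_fan (P : 'M[R]_p) t : orthoproj P -> \tr P <= t%:R -> (t <= p)%N ->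
  \tr (P *m (A *m A^T)) <= \sum_(0 <= i < t) sing_val A i ^+ 2.
Proof.
move=> oP trP tp; have [E [EE ->]] := gram_spectral A.
have EE' : E *m E^T = 1%:M by apply: mulmx1C.
pose w i := (E^T *m P *m E) i i.
have w01 i : 0 <= w i <= 1.
  apply: orthoproj_diag; case: oP => PT PP; split.
    by rewrite !trmx_mul trmxK PT mulmxA.
  by rewrite !mulmxA -(mulmxA _ E E^T) EE' mulmx1 -(mulmxA _ P P) PP.
have sw : \sum_i w i <= t%:R.
  suff -> : \sum_i w i = \tr P by [].
  by rewrite -/(\tr _) -mulmxA mxtrace_mulC -mulmxA EE' mulmx1.
pose s i := sing_val A i ^+ 2; pose b i : R := (i < t)%:R.
have sumb (g : nat -> R) : \sum_(0 <= i < t) g i = \sum_(i < p) g i * b i.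
  rewrite big_mkord (big_ord_widen _ g tp) big_mkcond /=.
  by apply: eq_bigr => i _; rewrite /b; case: ifP; rewrite (mulr1, mulr0).
have sb : \sum_(i < p) b i = t%:R.
  rewrite -[in RHS](subn0 t) -sumr_const_nat sumb.
  by apply: eq_bigr => i _; rewrite mul1r.
rewrite !mulmxA mxtrace_mulC !mulmxA mul_mx_diag sumb.
(* The factors [s i - s t] and [b i - w i] are both nonnegative for [i < t] and both nonpositive
   otherwise, which gives the bound termwise. The corrections then sum to [s t] times a nonpositive
   number. *)
apply: (@le_trans _ _ (\sum_(i < p) (s i * b i + s t * (w i - b i)))).
  apply: ler_sum => i _; rewrite mxE [X in _ * X <= _]mxE -/(s i) -/(w i).
  have /andP[w0 w1] := w01 i; have s0 : 0 <= s i by apply: sqr_ge0.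
  rewrite /b; case: (ltnP i t) => it /=.
    have : s t <= s i by apply: sing_val_sq_le; apply: ltnW.
    by nra.
  have : s i <= s t by apply: sing_val_sq_le.
  by nra.
rewrite big_split /= gerDl -mulr_sumr sumrB sb.
by rewrite mulr_ge0_le0 ?sqr_ge0 // subr_le0.
Qed.

(** The equality case of Ky Fan's inequality: the columns of [U] are eigenvectors for the first [t]
    eigenvalues. *)
Lemma leading_trace t (U : 'M[R]_(p, t)) : leading_left_svecs A U ->
  \tr (U *m U^T *m (A *m A^T)) = \sum_(0 <= i < t) sing_val A i ^+ 2.
Proof.
move=> [UU AU].
have -> : U *m U^T *m (A *m A^T) = U *m (U^T *m (A *m A^T)) by rewrite !mulmxA.
rewrite mxtrace_mulC -mulmxA.
have -> : A *m A^T *m U = U *m diag_mx (\row_i sing_val A i ^+ 2).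
  apply/matrixP=> i j; have /colP/(_ i) := AU j.
  by rewrite {1}colE mulmxA -colE mul_mx_diag !mxE mulrC.
rewrite mulmxA UU mul1mx mxtrace_diag big_mkord.
by apply: eq_bigr => i _; rewrite mxE.
Qed.

Lemma leading_exists t : (t <= p)%N ->
  exists U : 'M[R]_(p, t), leading_left_svecs A U.
Proof.
move=> tp; have [E [EE AE]] := gram_spectral A.
exists (E *m pid_mx t); split.
  rewrite trmx_mul tr_pid_mx mulmxA -(mulmxA _ E^T) EE mulmx1.
  by rewrite pid_mx_id // pid_mx_1.
move=> i; pose D m : 'rV[R]_m := \row_j sing_val A j ^+ 2.
have DE : diag_mx (D p) *m pid_mx t = (pid_mx t : 'M_(p, t)) *m diag_mx (D t).
  apply/matrixP=> a b; rewrite mul_mx_diag mul_diag_mx !mxE mulrC.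
  by case: eqP => [->|]; rewrite // !mul0r.
have AEt : A *m A^T *m (E *m pid_mx t) = E *m pid_mx t *m diag_mx (D t).
  by rewrite AE -!mulmxA (mulmxA E^T) EE mul1mx DE.
rewrite [in LHS]colE mulmxA AEt -colE.
by apply/colP=> a; rewrite mxE mul_mx_diag [RHS]mxE !mxE mulrC.
Qed.

End LowRank.

(** * Mode products as operators on a cube of side [N] *)

Section ModeOperators.
Variables (R : realType) (d N : nat).
Implicit Types (k j : 'I_d) (M P : 'M[R]_N) (s : seq 'I_d).

Notation index := {ffun 'I_d -> 'I_N}.
Notation cube := {ffun index -> R}.
Implicit Types (T Z : cube) (i : index).

Definition set_mode i k (a : 'I_N) : index :=
  [ffun j => if j == k then a else i j].

Definition mode_op k M T : cube :=
  [ffun i : index => \sum_a M (i k) a * T (set_mode i k a)].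

Definition dot T Z : R := \sum_i T i * Z i.

Definition nrm2 T : R := dot T T.

Lemma set_mode_same i k a : set_mode i k a k = a.
Proof. by rewrite ffunE eqxx. Qed.

Lemma set_mode_other i k j a : j != k -> set_mode i k a j = i j.
Proof. by rewrite ffunE => /negbTE->. Qed.

Lemma set_mode2 i k a b : set_mode (set_mode i k a) k b = set_mode i k b.
Proof. by apply/ffunP=> j; rewrite !ffunE; case: eqP. Qed.

Lemma set_mode_id i k : set_mode i k (i k) = i.
Proof. by apply/ffunP=> j; rewrite !ffunE; case: eqP => [->|]. Qed.

Lemma set_modeC i k j a b : j != k ->
  set_mode (set_mode i k a) j b = set_mode (set_mode i j b) k a.
Proof.
move=> jk; apply/ffunP=> l; rewrite !ffunE.
by case: eqP => [->|//]; rewrite (negbTE jk).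
Qed.

Lemma mode_opM k M P T : mode_op k M (mode_op k P T) = mode_op k (M *m P) T.
Proof.
apply/ffunP=> i; rewrite !ffunE.
under eq_bigr => a _ do rewrite ffunE set_mode_same mulr_sumr.
rewrite exchange_big /=; apply: eq_bigr => b _.
rewrite mxE mulr_suml; apply: eq_bigr => a _.
by rewrite set_mode2 mulrA.
Qed.

Lemma mode_opC k j M P T : j != k ->
  mode_op k M (mode_op j P T) = mode_op j P (mode_op k M T).
Proof.
move=> jk; apply/ffunP=> i; rewrite !ffunE.
under eq_bigr => a _ do rewrite ffunE mulr_sumr.
under [RHS]eq_bigr => a _ do rewrite ffunE mulr_sumr.
rewrite exchange_big /=; apply: eq_bigr => b _; apply: eq_bigr => a _.
rewrite !set_mode_other // 1?eq_sym // mulrCA.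
by rewrite set_modeC.
Qed.

Lemma mode_opD k M T Z : mode_op k M (T + Z) = mode_op k M T + mode_op k M Z.
Proof.
apply/ffunP=> i; rewrite !ffunE -big_split /=; apply: eq_bigr => a _.
by rewrite !ffunE mulrDr.
Qed.

Lemma mode_opN k M T : mode_op k M (- T) = - mode_op k M T.
Proof.
apply/ffunP=> i; rewrite !ffunE -sumrN; apply: eq_bigr => a _.
by rewrite !ffunE mulrN.
Qed.

Lemma mode_opB k M T Z : mode_op k M (T - Z) = mode_op k M T - mode_op k M Z.
Proof. by rewrite mode_opD mode_opN. Qed.

(** Exchanging the entry [i k] with [a] is an involution on pairs; this is what gives the adjoint of
    a mode operator. *)
Lemma sum_set_mode k (F : index -> 'I_N -> R) :
  \sum_i \sum_a F i a = \sum_i \sum_a F (set_mode i k a) (i k).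
Proof.
rewrite !pair_bigA /=.
pose h (x : index * 'I_N) := (set_mode x.1 k x.2, x.1 k).
have hK : involutive h.
  by move=> [i a]; rewrite /h /= set_mode2 set_mode_id set_mode_same.
by rewrite (reindex_inj (inv_inj hK)).
Qed.

Lemma dot_mode_op k M T Z : dot (mode_op k M T) Z = dot T (mode_op k M^T Z).
Proof.
rewrite /dot.
under eq_bigr => i _ do rewrite ffunE mulr_suml.
under [RHS]eq_bigr => i _ do rewrite ffunE mulr_sumr.
rewrite (sum_set_mode k); apply: eq_bigr => i _; apply: eq_bigr => a _.
by rewrite set_mode2 set_mode_id set_mode_same mxE mulrCA mulrA.
Qed.

Lemma dotC T Z : dot T Z = dot Z T.
Proof. by apply: eq_bigr => i _; rewrite mulrC. Qed.

Lemma dotDl T1 T2 Z : dot (T1 + T2) Z = dot T1 Z + dot T2 Z.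
Proof. by rewrite -big_split; apply: eq_bigr => i _; rewrite ffunE mulrDl. Qed.

Lemma dotNl T Z : dot (- T) Z = - dot T Z.
Proof. by rewrite -sumrN; apply: eq_bigr => i _; rewrite ffunE mulNr. Qed.

Lemma dotBl T1 T2 Z : dot (T1 - T2) Z = dot T1 Z - dot T2 Z.
Proof. by rewrite dotDl dotNl. Qed.

Lemma dotBr T Z1 Z2 : dot T (Z1 - Z2) = dot T Z1 - dot T Z2.
Proof. by rewrite dotC dotBl !(dotC _ T). Qed.

Lemma nrm2_0 : nrm2 0 = 0.
Proof. by rewrite /nrm2 /dot big1 // => i _; rewrite ffunE mul0r. Qed.

Lemma nrm2_ge0 T : 0 <= nrm2 T.
Proof. by apply: sumr_ge0 => i _; rewrite -expr2 sqr_ge0. Qed.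

Section Projection.
Variables (k : 'I_d) (P : 'M[R]_N).
Hypothesis oP : orthoproj P.

Lemma dot_proj T Z :
  dot (mode_op k P T) (mode_op k P Z) = dot (mode_op k P T) Z.
Proof. by case: oP => PT PP; rewrite dotC dot_mode_op PT mode_opM PP dotC. Qed.

(** [T - P Z] is the sum of [T - P T], in the kernel of the projection, and [P (T - Z)], in its
    range. *)
Lemma pythagoras T Z :
  nrm2 (T - mode_op k P Z) =
    nrm2 (T - mode_op k P T) + nrm2 (mode_op k P (T - Z)).
Proof.
rewrite /nrm2 mode_opB !dotBl !dotBr !dot_proj.
rewrite (dotC T (mode_op k P Z)) (dotC T (mode_op k P T)).
have -> : dot (mode_op k P T) Z = dot (mode_op k P Z) T.
  by case: oP => PT PP; rewrite dot_mode_op PT dotC.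
ring.
Qed.

Lemma nrm2_residual T :
  nrm2 (T - mode_op k P T) = nrm2 T - dot (mode_op k P T) T.
Proof.
rewrite /nrm2 !dotBl !dotBr !dot_proj (dotC T (mode_op k P T)); ring.
Qed.

Lemma nrm2_proj_le T : nrm2 (mode_op k P T) <= nrm2 T.
Proof.
rewrite /nrm2 dot_proj -subr_ge0 -/(nrm2 T) -nrm2_residual; exact: nrm2_ge0.
Qed.

Lemma nrm2_residual_le T Z : mode_op k P Z = Z ->
  nrm2 (T - mode_op k P T) <= nrm2 (T - Z).
Proof. by move=> {1}<-; rewrite (pythagoras T Z) lerDl nrm2_ge0. Qed.

End Projection.

Fixpoint mode_ops (F : 'I_d -> 'M[R]_N) s T : cube :=
  if s is k :: s' then mode_ops F s' (mode_op k (F k) T) else T.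

Implicit Types (F G : 'I_d -> 'M[R]_N).

Lemma mode_opsC F s k M T : k \notin s ->
  mode_op k M (mode_ops F s T) = mode_ops F s (mode_op k M T).
Proof.
elim: s T => //= j s IH T; rewrite inE negb_or => /andP[kj ks].
by rewrite IH // mode_opC // eq_sym.
Qed.

Lemma mode_ops_cat F s1 s2 T :
  mode_ops F (s1 ++ s2) T = mode_ops F s2 (mode_ops F s1 T).
Proof. by elim: s1 T => /=. Qed.

Lemma mode_ops_perm F s1 s2 T : uniq s1 -> perm_eq s1 s2 ->
  mode_ops F s1 T = mode_ops F s2 T.
Proof.
elim: s1 s2 T => [|k s1 IH] s2 T.
  by move=> _; rewrite perm_sym => /perm_nilP ->.
move=> /andP[ks us] p12.
have ks2 : k \in s2 by rewrite -(perm_mem p12) mem_head.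
case/splitPr: s2 / ks2 p12 => a b p12.
have p12' : perm_eq s1 (a ++ b).
  rewrite -(perm_cons k) (perm_trans p12) //.
  by rewrite perm_catC /= perm_cons perm_catC.
have ka : k \notin a.
  by move: ks; rewrite (perm_mem p12') mem_cat negb_or => /andP[].
by rewrite /= (IH (a ++ b)) // !mode_ops_cat /= mode_opsC.
Qed.

Lemma mode_ops_fuse F G s T : uniq s ->
  mode_ops F s (mode_ops G s T) = mode_ops (fun k => F k *m G k) s T.
Proof.
elim: s T => //= k s IH T /andP[ks us].
by rewrite mode_opsC // mode_opM IH.
Qed.

End ModeOperators.

(** * Zero-padded matrices *)

Section PaddedMatrices.
Variables (R : realType) (N : nat).

(** The corner embedding is written with rectangular partial identities, so that products and
    transposes follow from the algebra of [pid_mx]. *)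
Definition mxpad p q (A : 'M[R]_(p, q)) : 'M[R]_N := pid_mx p *m A *m pid_mx q.

Lemma mxpad_in p q (A : 'M[R]_(p, q)) (i j : 'I_N) (a : 'I_p) (b : 'I_q) :
  i = a :> nat -> j = b :> nat -> mxpad A i j = A a b.
Proof.
move=> ia jb; rewrite /mxpad mxE (bigD1 b) //= [X in _ + X]big1 => [|b' b'b].
  rewrite [pid_mx q _ _]mxE jb eqxx ltn_ord mulr1 addr0.
  rewrite mxE (bigD1 a) //= [X in _ + X]big1 => [|a' a'a].
    by rewrite !mxE ia eqxx ltn_ord mul1r addr0.
  by rewrite mxE ia eq_sym (inj_eq val_inj) (negbTE a'a) mul0r.
by rewrite [pid_mx q _ _]mxE jb (inj_eq val_inj) (negbTE b'b) mulr0.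
Qed.

Lemma mxpad_out_row p q (A : 'M[R]_(p, q)) (i j : 'I_N) :
  (p <= i)%N -> mxpad A i j = 0.
Proof.
move=> pi; rewrite /mxpad -mulmxA mxE big1 // => a _.
by rewrite mxE ltnNge pi andbF mul0r.
Qed.

Lemma mxpad_out_col p q (A : 'M[R]_(p, q)) (i j : 'I_N) :
  (q <= j)%N -> mxpad A i j = 0.
Proof.
move=> qj; rewrite /mxpad mxE big1 // => b _.
rewrite [pid_mx q _ _]mxE; case: eqP => [bj|]; last by rewrite mulr0.
by move: (ltn_ord b); rewrite bj ltnNge qj.
Qed.

Lemma mxpadM p q r (A : 'M[R]_(p, q)) (B : 'M_(q, r)) : (q <= N)%N ->
  mxpad (A *m B) = mxpad A *m mxpad B.
Proof.
move=> qN; rewrite /mxpad -!mulmxA (mulmxA (pid_mx q) (pid_mx q)).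
by rewrite pid_mx_id // pid_mx_1 mul1mx.
Qed.

Lemma mxpad_tr p q (A : 'M[R]_(p, q)) : (mxpad A)^T = mxpad A^T.
Proof. by rewrite /mxpad !trmx_mul !tr_pid_mx mulmxA. Qed.

Lemma mxpad_conform p q p' q' (B : 'M[R]_(p', q')) (A : 'M[R]_(p, q)) :
  p = p' -> q = q' -> mxpad (conform_mx B A) = mxpad A.
Proof. by move=> ep eq; subst p' q'; rewrite conform_mx_id. Qed.

Lemma orthoproj_mxpad p (P : 'M[R]_p) :
  (p <= N)%N -> orthoproj P -> orthoproj (mxpad P).
Proof.
by move=> pN [PT PP]; split; rewrite ?mxpad_tr ?PT // -mxpadM ?PP.
Qed.

End PaddedMatrices.

Lemma mxtrace_conform (R : realType) p p' (A : 'M[R]_p) (B : 'M[R]_p') :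
  p = p' -> \tr (conform_mx B A) = \tr A.
Proof. by move=> e; subst p'; rewrite conform_mx_id. Qed.

Lemma orthoproj_conform (R : realType) p p' (A : 'M[R]_p) (B : 'M[R]_p') :
  p = p' -> orthoproj A -> orthoproj (conform_mx B A).
Proof. by move=> e; subst p'; rewrite conform_mx_id. Qed.

(** * Splitting a multi-index into row and column of an unfolding *)

Section MultiIndices.
Variables (d : nat) (n : 'I_d -> nat) (k : 'I_d).

Lemma insert_idx_same (a : 'I_(n k)) (c : cidx n k) :
  insert_idx a c k = a :> nat.
Proof. by rewrite ffunE; case: (k =P k). Qed.

Lemma insert_idx_other (a : 'I_(n k)) (c : cidx n k) j (jk : j != k) :
  insert_idx a c j = c (exist _ j jk) :> nat.
Proof.
rewrite ffunE; case: (j =P k) => [e|ne]; first by case/negP: (jk); apply/eqP.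
by rewrite (bool_irrelevance (neq_bool ne) jk).
Qed.

Lemma sum_insert_idx (R : nmodType) (F : midx n -> R) :
  \sum_x F x = \sum_(a < n k) \sum_(c : cidx n k) F (insert_idx a c).
Proof.
rewrite pair_bigA /=.
apply: (reindex (fun x : 'I_(n k) * cidx n k => insert_idx x.1 x.2)).
apply: onW_bij.
exists (fun x : midx n => (x k, [ffun j => x (val j)] : cidx n k)).
  move=> [a c]; congr pair; first by apply/val_inj; rewrite /= insert_idx_same.
  apply/ffunP=> -[j jk]; rewrite ffunE; apply/val_inj.
  by rewrite /= (insert_idx_other _ _ jk).
move=> x; apply/ffunP=> j; apply/val_inj; rewrite /=.
have [->|jk] := eqVneq j k; first by rewrite insert_idx_same.
by rewrite (insert_idx_other _ _ jk) ffunE.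
Qed.

End MultiIndices.

(** * Extension of tensors by zero *)

Section Padding.
Variables (R : realType) (d N : nat).
Implicit Types (n m q : 'I_d -> nat) (k : 'I_d).

Notation index := {ffun 'I_d -> 'I_N}.
Notation cube := {ffun index -> R}.

Definition dims_le n := forall j, (n j <= N)%N.

(** The sum has at most one term, and none outside the box [n]; it extends [X] by zero without
    casting [i] to a multi-index. *)
Definition pad n (X : tensor R n) : cube :=
  [ffun i : index =>
    \sum_(a : midx n | [forall j, val (a j) == val (i j)]) X a].

Lemma pad_in n (X : tensor R n) (i : index) (a : midx n) :
  (forall j, a j = i j :> nat) -> pad X i = X a.
Proof.
move=> ai; rewrite ffunE (big_pred1 a) // => b.
apply/forallP/eqP => [bi|-> j]; last by rewrite /= ai.
by apply/ffunP=> j; apply/val_inj; rewrite /= ai; apply/eqP/bi.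
Qed.

Lemma pad_out n (X : tensor R n) (i : index) j : (n j <= i j)%N -> pad X i = 0.
Proof.
move=> nj; rewrite ffunE big_pred0 // => a; apply/negbTE/forallPn; exists j.
by rewrite neq_ltn (leq_trans (ltn_ord _) nj).
Qed.

Lemma index_cases n (i : index) :
  (exists j, (n j <= i j)%N) \/ exists a : midx n, forall j, a j = i j :> nat.
Proof.
have [/forallP h|/forallPn[j]] := boolP [forall j, (i j < n j)%N]; last first.
  by rewrite -leqNgt => nj; left; exists j.
by right; exists [ffun j => Ordinal (h j)] => j; rewrite ffunE.
Qed.

Lemma pad_retype n m (X : tensor R n) : n =1 m -> pad (retype m X) = pad X.
Proof.
move=> nm; apply/ffunP=> i; have [[j nj]|[a ai]] := index_cases m i.
  by rewrite !(pad_out _ (j := j)) ?nm.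
rewrite (pad_in _ ai) !ffunE; apply: eq_bigl => b.
by apply: eq_forallb => j; rewrite /= ai.
Qed.

Lemma padB n (X Y : tensor R n) : pad (X - Y) = pad X - pad Y.
Proof.
apply/ffunP=> i; rewrite !ffunE -sumrB.
by apply: eq_bigr => a _; rewrite !ffunE.
Qed.

Definition widen_idx n (nN : dims_le n) (a : midx n) : index :=
  [ffun j => widen_ord (nN j) (a j)].

Lemma dot_pad n (nN : dims_le n) (T : cube) (X : tensor R n) :
  dot T (pad X) = \sum_a T (widen_idx nN a) * X a.
Proof.
rewrite /dot; under eq_bigr => i _ do rewrite ffunE mulr_sumr big_mkcond.
rewrite exchange_big /=; apply: eq_bigr => a _; rewrite -big_mkcond /=.
rewrite (big_pred1 (widen_idx nN a)) // => i.
apply/forallP/eqP => [ai|-> j]; last by rewrite ffunE.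
by apply/ffunP=> j; apply/val_inj; rewrite ffunE /=; apply/esym/eqP/ai.
Qed.

Lemma sum_widen (q : nat) (qN : (q <= N)%N) (F : 'I_N -> R) :
  (forall b : 'I_N, (q <= b)%N -> F b = 0) ->
  \sum_b F b = \sum_(b < q) F (widen_ord qN b).
Proof.
move=> F0; rewrite -(@big_ord_narrow _ _ _ _ _ _ qN) [RHS]big_mkcond /=.
by apply: eq_bigr => b _; case: ltnP => // /F0.
Qed.

(** Outside the box of the result both sides vanish; inside it the extra terms of the longer sum
    carry padded zeros of [M]. *)
Lemma pad_mode_prod n k p (M : 'M[R]_(p, n k)) (X : tensor R n) :
  dims_le n -> pad (mode_prod M X) = mode_op k (mxpad N M) (pad X).
Proof.
move=> nN; apply/ffunP=> i; rewrite [RHS]ffunE.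
have [[j nj]|[x xi]] := index_cases (upd n k p) i.
  rewrite (pad_out _ nj) big1 // => a _; have [jk|jk] := eqVneq j k.
    by rewrite jk upd_same in nj; rewrite mxpad_out_row ?mul0r.
  rewrite upd_other // in nj.
  by rewrite (pad_out _ (j := j)) ?mulr0 ?set_mode_other.
rewrite (pad_in _ xi) ffunE mxE (sum_widen (nN k)) => [|b nb]; last first.
  by rewrite mxpad_out_col ?mul0r.
apply: eq_bigr => b _; rewrite mxE enum_rankK; congr (_ * _).
  by apply/esym/mxpad_in => //=; rewrite -xi.
apply/esym/pad_in => j; have [->|jk] := eqVneq j k.
  by rewrite insert_idx_same set_mode_same.
by rewrite (insert_idx_other _ _ jk) set_mode_other // ffunE /= xi.
Qed.

Lemma nrm2_pad n (X : tensor R n) :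
  dims_le n -> nrm2 (pad X) = frobenius X ^+ 2.
Proof.
move=> nN; rewrite /nrm2 (dot_pad nN) sqr_sqrtr; last first.
  by apply: sumr_ge0 => a _; apply: sqr_ge0.
apply: eq_bigr => a _; rewrite (pad_in _ (a := a)) ?expr2 // => j.
by rewrite ffunE.
Qed.

Lemma gram_unfold_trace n k (X : tensor R n) :
  \tr (unfold k X *m (unfold k X)^T) = frobenius X ^+ 2.
Proof.
rewrite sqr_sqrtr; last by apply: sumr_ge0 => a _; apply: sqr_ge0.
rewrite (sum_insert_idx k); apply: eq_bigr => a _; rewrite gram_diag.
rewrite [RHS](reindex (fun c : 'I_#|{: cidx n k}| => enum_val c)) /=;
  last exact/onW_bij/enum_val_bij.
by apply: eq_bigr => c _; rewrite mxE.
Qed.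

(** For a projection [P] this is the energy it keeps, as a trace to which Ky Fan's inequality
    applies. *)
Lemma dot_mode_op_pad n k (P : 'M[R]_(n k)) (X : tensor R n) : dims_le n ->
  dot (mode_op k (mxpad N P) (pad X)) (pad X) =
  \tr (P *m (unfold k X *m (unfold k X)^T)).
Proof.
move=> nN; rewrite (dot_pad nN) (sum_insert_idx k) mulmxA.
apply: eq_bigr => a _; rewrite mxE.
rewrite (reindex (fun c : 'I_#|{: cidx n k}| => enum_val c)) /=;
  last exact/onW_bij/enum_val_bij.
apply: eq_bigr => c _; rewrite [(unfold k X)^T _ _]mxE [unfold k X a c]mxE.
congr (_ * _); rewrite ffunE mxE (sum_widen (nN k)) => [|b nb]; last first.
  by rewrite mxpad_out_col ?mul0r.
apply: eq_bigr => b _; rewrite [unfold k X b _]mxE; congr (_ * _).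
  by apply: mxpad_in; rewrite // ffunE /= insert_idx_same.
apply: pad_in => j; have [->|jk] := eqVneq j k.
  by rewrite insert_idx_same set_mode_same.
rewrite !(insert_idx_other _ _ jk) set_mode_other // ffunE /=.
by rewrite (insert_idx_other _ _ jk).
Qed.

End Padding.

(** * Truncation errors in the cube *)

Section PaddedErrors.
Variables (R : realType) (d N : nat).
Implicit Types (n m q r : 'I_d -> nat) (k j : 'I_d) (s : seq 'I_d).

Notation cube := {ffun {ffun 'I_d -> 'I_N} -> R}.
Implicit Types T Z : cube.

Lemma sq_tail_split p c (A : 'M[R]_(p, c)) t : (t <= p)%N ->
  \tr (A *m A^T) = \sum_(0 <= i < t) sing_val A i ^+ 2 + sq_tail A t.
Proof. by move=> tp; rewrite gram_trace -big_cat_nat. Qed.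

Lemma nrm2_residual_pad n k (X : tensor R n) (P : 'M_(n k)) : dims_le N n ->
  orthoproj P ->
  nrm2 (pad N X - mode_op k (mxpad N P) (pad N X)) =
  \tr (unfold k X *m (unfold k X)^T) -
    \tr (P *m (unfold k X *m (unfold k X)^T)).
Proof.
move=> nN oP; rewrite nrm2_residual; last exact: orthoproj_mxpad.
by rewrite dot_mode_op_pad // nrm2_pad // -(gram_unfold_trace k).
Qed.

(** The discarded energy is the total minus the kept energy, and Ky Fan bounds the latter. *)
Lemma residual_ge n k (X : tensor R n) (P : 'M_(n k)) t : dims_le N n ->
  orthoproj P -> \tr P <= t%:R -> (t <= n k)%N ->
  sq_tail (unfold k X) t <= nrm2 (pad N X - mode_op k (mxpad N P) (pad N X)).
Proof.
move=> nN oP trP tn; rewrite nrm2_residual_pad // (sq_tail_split _ tn).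
by rewrite addrAC lerDr subr_ge0 ky_fan.
Qed.

Lemma residual_leading n k (X : tensor R n) t (U : 'M_(n k, t)) : dims_le N n ->
  (t <= n k)%N -> leading_left_svecs (unfold k X) U ->
  nrm2 (pad N X - mode_op k (mxpad N (U *m U^T)) (pad N X)) =
  sq_tail (unfold k X) t.
Proof.
move=> nN tn lU; have [oU _] := orthoproj_frame lU.1.
rewrite nrm2_residual_pad // leading_trace // (sq_tail_split _ tn).
by rewrite addrAC subrr add0r.
Qed.

(** With the projection [Q = M^T M], the squared norm of the image is [dot T (Q T)], which is the
    squared norm of [Q T]. *)
Lemma nrm2_contraction k (M : 'M_N) T :
  orthoproj (M^T *m M) -> nrm2 (mode_op k M T) <= nrm2 T.
Proof.
move=> oM; rewrite {1}/nrm2 dot_mode_op mode_opM dotC -(dot_proj k oM).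
exact: nrm2_proj_le.
Qed.

(* Project both tensors onto the leading mode-j singular vectors of H. *)
Lemma sq_tail_contraction q q' j k (H : tensor R q) (H' : tensor R q')
    (W : 'M_N) t :
  dims_le N q -> dims_le N q' -> j != k -> q' j = q j ->
  pad N H' = mode_op k W (pad N H) -> orthoproj (W^T *m W) -> (t <= q j)%N ->
  sq_tail (unfold j H') t <= sq_tail (unfold j H) t.
Proof.
move=> qN qN' jk ej H'E oW tj.
have [U lU] := leading_exists (unfold j H) tj.
have [oU trU] := orthoproj_frame lU.1.
pose P' : 'M_(q' j) := conform_mx 0 (U *m U^T).
rewrite -(residual_leading qN tj lU).
apply: (@le_trans _ _ (nrm2 (pad N H' - mode_op j (mxpad N P') (pad N H')))).
  apply: residual_ge => //; last by rewrite ej.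
    exact: orthoproj_conform.
  by rewrite mxtrace_conform // trU.
(* Modes [j] and [k] commute, so the residual of [H'] is [W] applied to the residual of [H]. *)
rewrite mxpad_conform // H'E mode_opC 1?eq_sym // -mode_opB.
exact: nrm2_contraction.
Qed.

Lemma dims_le_upd n k p : dims_le N n -> (p <= N)%N -> dims_le N (upd n k p).
Proof. by move=> nN pN j; rewrite /upd; case: ifP. Qed.

(** The induction invariant is that the current tensor has dimensions [n] on the modes still in [s]
    and [m] elsewhere; under it [conform_mx] and [retype] are casts, which padding erases. *)
Lemma pad_mode_prods_seq n m (M : forall k, 'M[R]_(m k, n k)) s q
    (Y : tensor R q) :
  uniq s -> dims_le N q -> dims_le N m ->
  (forall k, k \in s -> q k = n k) -> (forall k, k \notin s -> q k = m k) ->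
  pad N (mode_prods_seq M s Y) = mode_ops (fun k => mxpad N (M k)) s (pad N Y).
Proof.
elim: s q Y => [|k s IH] q Y /=.
  by move=> _ _ _ _ qm; apply: pad_retype => k; apply: qm.
move=> /andP[ks us] qN mN qn qm; rewrite IH //.
- rewrite pad_mode_prod // mxpad_conform //.
  by apply/esym/qn; rewrite mem_head.
- exact: dims_le_upd.
- move=> j js; rewrite upd_other ?qn ?inE ?js ?orbT //.
  by apply: contraNneq ks => <-.
- move=> j js; have [->|jk] := eqVneq j k; first by rewrite upd_same.
  by rewrite upd_other // qm // inE negb_or jk.
Qed.

Lemma pad_mode_prods n m (M : forall k, 'M[R]_(m k, n k)) (X : tensor R n) :
  dims_le N n -> dims_le N m ->
  pad N (mode_prods M X) =
    mode_ops (fun k => mxpad N (M k)) (enum 'I_d) (pad N X).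
Proof.
move=> nN mN; apply: pad_mode_prods_seq; rewrite ?enum_uniq // => k.
by rewrite mem_enum.
Qed.

(** By Pythagoras the error is the residual of mode [k] plus a projection of the error over the
    other modes, and projecting does not increase the latter. *)
Lemma mode_ops_error (F : 'I_d -> 'M[R]_N) s T : uniq s ->
  (forall k, orthoproj (F k)) ->
  nrm2 (T - mode_ops F s T) <= \sum_(k <- s) nrm2 (T - mode_op k (F k) T).
Proof.
move=> + oF; elim: s => [_|k s IH /= /andP[ks us]].
  by rewrite big_nil subrr nrm2_0.
rewrite -mode_opsC // pythagoras // big_cons lerD2l.
exact: le_trans (nrm2_proj_le _ (oF k) _) (IH us).
Qed.

(** Each truncation error is orthogonal to what follows, and the remaining error is that of the
    smaller core, whose tails are at most those of [H]. The formula for [G] serves to recognise the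
    output as a projection of the input. *)
Lemma sthosvd_error n r (U : forall k, 'M[R]_(n k, r k)) s q
    (H : tensor R q) G :
  uniq s -> dims_le N q -> dims_le N r ->
  (forall k, k \in s -> q k = n k) -> (forall k, k \notin s -> q k = r k) ->
  (forall k, (r k <= n k)%N) -> st_core U s H G ->
  pad N G = mode_ops (fun k => mxpad N (U k)^T) s (pad N H) /\
  nrm2 (pad N H - mode_ops (fun k => mxpad N (U k *m (U k)^T)) s (pad N H)) <=
    \sum_(k <- s) sq_tail (unfold k H) (r k).
Proof.
move=> + + rN + + rn; elim: s q H => [|k s IH] q H /=.
  move=> _ _ _ qr ->; split; first by apply: pad_retype => k; apply: qr.
  by rewrite big_nil subrr nrm2_0.
move=> /andP[ks us] qN qn qr [lV core].
set V : 'M_(q k, r k) := conform_mx 0 (U k) in lV core.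
have qk : n k = q k by apply/esym/qn; rewrite mem_head.
have VU : mxpad N V = mxpad N (U k) by apply: mxpad_conform.
have VtU : mxpad N V^T = mxpad N (U k)^T by rewrite -!mxpad_tr VU.
have PV : mxpad N (U k *m (U k)^T) = mxpad N (V *m V^T).
  by rewrite !mxpadM // VU VtU.
have [oV _] := orthoproj_frame lV.1.
have oP : orthoproj (mxpad N (V *m V^T)) by apply: orthoproj_mxpad.
(* Both [V^T] and [V] are contractions: the first compares the tails of the new core with those of
   [H], the second carries the error of the core back. *)
have oVV : orthoproj ((mxpad N V^T)^T *m mxpad N V^T).
  by rewrite mxpad_tr trmxK -mxpadM.
have oV1 : orthoproj ((mxpad N V)^T *m mxpad N V).
  rewrite mxpad_tr -mxpadM // lV.1; apply: orthoproj_mxpad => //.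
  by split; rewrite ?trmx1 ?mulmx1.
have qN' : dims_le N (upd q k (r k)) by apply: dims_le_upd.
have sk j : j \in s -> j != k by apply: contraTneq => ->.
have H'E : pad N (mode_prod V^T H) = mode_op k (mxpad N V^T) (pad N H).
  exact: pad_mode_prod.
have [||GE err] := IH _ _ us qN' _ _ core.
- by move=> j js; rewrite upd_other ?sk // qn // inE js orbT.
- move=> j js; have [->|jk] := eqVneq j k; first by rewrite upd_same.
  by rewrite upd_other // qr // inE negb_or jk.
split; first by rewrite GE H'E VtU.
rewrite PV -mode_opsC // pythagoras // big_cons.
rewrite residual_leading ?lerD2l -?qk //.
(* The projection is [V] after [V^T]: [V] contracts, and [V^T] commutes with the other modes, which
   leaves the error of the new core. *)
rewrite mxpadM // -mode_opM; apply: le_trans (nrm2_contraction _ _ oV1) _.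
rewrite mode_opB mode_opsC // -H'E; apply: le_trans err _.
rewrite big_seq_cond [leRHS]big_seq_cond; apply: ler_sum => j /andP[js _].
apply: (sq_tail_contraction qN qN' (sk _ js) _ H'E oVV).
  by rewrite upd_other ?sk.
by rewrite qn ?rn // inE js orbT.
Qed.

(** The factor [U] puts [Y] in the range of a projection of trace at most [t]. Projecting [X] comes
    at least as close as [Y], and Ky Fan bounds that residual below. *)
Lemma eckart_young n k (X Y : tensor R n) t (U : 'M_(n k, t)) Z : dims_le N n ->
  (t <= n k)%N -> pad N Y = mode_op k (mxpad N U) Z ->
  sq_tail (unfold k X) t <= frobenius (X - Y) ^+ 2.
Proof.
move=> nN tn YE; have [P [oP trP PU]] := orthoproj_range U.
rewrite -(nrm2_pad _ nN) padB; apply: le_trans (residual_ge X nN oP trP tn) _.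
apply: nrm2_residual_le; first exact: orthoproj_mxpad.
by rewrite YE mode_opM -mxpadM // PU.
Qed.

Lemma mode_ops_enum (F : 'I_d -> 'M[R]_N) k T :
  exists Z, mode_ops F (enum 'I_d) T = mode_op k (F k) Z.
Proof.
exists (mode_ops F (rem k (enum 'I_d)) T).
rewrite mode_opsC ?mem_rem_uniqF ?enum_uniq //.
rewrite (mode_ops_perm _ _ (enum_uniq _) (perm_to_rem (x := k) _)) //.
by rewrite mem_enum.
Qed.

End PaddedErrors.

(** * Error bounds for Tucker, HOSVD and ST-HOSVD approximations *)

Section TuckerApproximation.
Variables (R : realType) (d : nat) (n r : 'I_d -> nat) (X : tensor R n).
Hypothesis rn : forall k, (r k <= n k)%N.

Let N := (\max_k n k)%N.

Let nN : dims_le N n.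
Proof. by move=> k; apply: leq_bigmax. Qed.

Let rN : dims_le N r.
Proof. by move=> k; apply: leq_trans (rn k) (nN k). Qed.

Lemma tucker_error_ge Y k : is_tucker r Y ->
  sq_tail (unfold k X) (r k) <= frobenius (X - Y) ^+ 2.
Proof.
move=> [G [U ->]]; have YE := pad_mode_prods U G rN nN.
have [Z ZE] := mode_ops_enum (fun k => mxpad N (U k)) k (pad N G).
by apply: (eckart_young X nN (rn k)); rewrite YE ZE.
Qed.

(** Of the square factor [U k *m (U k)^T] only [U k] is kept and the rest goes into [Z], so that the
    number of columns is [r k]. *)
Lemma hosvd_error_ge Y k : is_hosvd r X Y ->
  sq_tail (unfold k X) (r k) <= frobenius (X - Y) ^+ 2.
Proof.
move=> [U [_ ->]]; have YE := pad_mode_prods (fun k => U k *m (U k)^T) X nN nN.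
have [Z ZE] := mode_ops_enum (fun k => mxpad N (U k *m (U k)^T)) k (pad N X).
apply: (eckart_young X nN (rn k)).
by rewrite YE ZE mxpadM ?rN // -mode_opM.
Qed.

Lemma hosvd_error_le Y : is_hosvd r X Y ->
  frobenius (X - Y) ^+ 2 <= \sum_k sq_tail (unfold k X) (r k).
Proof.
move=> [U [lU ->]].
rewrite -(nrm2_pad _ nN) padB (pad_mode_prods _ X nN nN).
apply: le_trans (mode_ops_error _ (enum_uniq _) _) _ => [k|].
  by apply: orthoproj_mxpad => //; case: (orthoproj_frame (lU k).1).
by rewrite big_enum; apply: ler_sum => k _; rewrite residual_leading.
Qed.

Lemma sthosvd_error_le Y : is_sthosvd r X Y ->
  frobenius (X - Y) ^+ 2 <= \sum_k sq_tail (unfold k X) (r k).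
Proof.
move=> [s [U [G [ps core ->]]]].
have us : uniq s by rewrite (perm_uniq ps) enum_uniq.
have sT k : k \in s by rewrite (perm_mem ps) mem_enum.
have [||GE err] := sthosvd_error us nN rN _ _ rn core => //.
  by move=> k; rewrite sT.
rewrite -(nrm2_pad _ nN) padB (pad_mode_prods _ G rN nN).
(* Reconstruction, put in the processing order, fuses with the transposed factors in the core into
   the projections [U k *m (U k)^T]. *)
rewrite -(mode_ops_perm _ _ us ps) GE mode_ops_fuse //.
apply: le_trans (le_trans _ err) _; last by rewrite (perm_big _ ps) big_enum.
rewrite le_eqVlt; apply/orP; left; apply/eqP; congr (nrm2 (_ - _)).
congr (mode_ops _ s _); apply/funext => k.
by rewrite mxpadM ?rN.
Qed.

End TuckerApproximation.

(** * Storage and surrogate under an exchange of ranks *)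

Section Allocation.
Variables (R : realType) (d : nat) (n : 'I_d -> nat) (X : tensor R n) (B : R).
Implicit Types (r : 'I_d -> nat) (j k m : 'I_d).

Lemma storage_mode r j : storage n r =
  (r j * \prod_(k | k != j) r k + (n j * r j + \sum_(k | k != j) n k * r k))%N.
Proof. by rewrite /storage (bigD1 j) //= [in X in (_ + X)%N](bigD1 j). Qed.

Lemma storage_increment r j :
  storage n (upd r j (r j).+1) = (storage n r + increment n j r)%N.
Proof.
rewrite !(storage_mode _ j) /increment upd_same.
set r' := upd r j _; have r'k k : k != j -> r' k = r k by apply: upd_other.
have -> : (\prod_(k | k != j) r' k = \prod_(k | k != j) r k)%N.
  exact: eq_bigr r'k.
have -> : (\sum_(k | k != j) n k * r' k = \sum_(k | k != j) n k * r k)%N.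
  by apply: eq_bigr => k kj; rewrite r'k.
set Q := (\prod_(k | _) _)%N; set W := (\sum_(k | _) _)%N; lia.
Qed.

(** Storage is affine in each rank. Lowering mode [m] by [p] saves [p] times its slope at the raised
    rank of [j], which is the denominator in [decrement]. *)
Lemma storage_exchange r j m p : m != j -> (p <= r m)%N ->
  (storage n (upd (upd r j (r j).+1) m (r m - p)) +
     p * (n m + (r j).+1 * \prod_(k | (k != j) && (k != m)) r k) =
   storage n r + increment n j r)%N.
Proof.
move=> mj pm; set r' := upd (upd r j _) _ _.
have r'j : r' j = (r j).+1 by rewrite /r' upd_other 1?eq_sym // upd_same.
have r'm : r' m = (r m - p)%N by rewrite /r' upd_same.
have r'k k : (k != j) && (k != m) -> r' k = r k.
  by case/andP => kj km; rewrite /r' !upd_other.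
rewrite !(storage_mode _ j) /increment.
rewrite !(bigD1 m (P := fun k => k != j)) //= r'j r'm.
have -> : (\prod_(k | (k != j) && (k != m)) r' k =
    \prod_(k | (k != j) && (k != m)) r k)%N by exact: eq_bigr r'k.
have -> : (\sum_(k | (k != j) && (k != m)) n k * r' k =
    \sum_(k | (k != j) && (k != m)) n k * r k)%N.
  by apply: eq_bigr => k kjm; rewrite r'k.
set Q := (\prod_(k | _) _)%N; set W := (\sum_(k | _) _)%N.
have -> : r m = (r m - p + p)%N by rewrite subnK.
rewrite addnK; nia.
Qed.

Lemma tail_energy_sq k t :
  tail_energy X k t ^+ 2 = sq_tail (unfold k X) t / frobenius X ^+ 2.
Proof.
rewrite sqr_sqrtr // divr_ge0 ?sqr_ge0 // sumr_ge0 // => i _; exact: sqr_ge0.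
Qed.

Lemma tail_energy_sq_cat k t u : (t <= u <= n k)%N ->
  tail_energy X k t ^+ 2 =
    (\sum_(t <= i < u) sing_val (unfold k X) i ^+ 2) / frobenius X ^+ 2
    + tail_energy X k u ^+ 2.
Proof.
move=> /andP[tu un]; rewrite !tail_energy_sq -mulrDl; congr (_ / _).
exact: big_cat_nat.
Qed.

Lemma tail_energy_full k : tail_energy X k (n k) ^+ 2 = 0.
Proof. by rewrite tail_energy_sq /sq_tail big_geq // mul0r. Qed.

(** One more rank gains a squared singular value, at least the last one, which alone makes up the
    tail at [(n k).-1]. *)
Lemma tail_energy_step k t : (t < n k)%N ->
  tail_energy X k (n k).-1 ^+ 2 + tail_energy X k t.+1 ^+ 2
    <= tail_energy X k t ^+ 2.
Proof.
move=> tn; rewrite (@tail_energy_sq_cat k t t.+1) ?leqnSn // lerD2r.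
have n1 : ((n k).-1.+1 = n k)%N by lia.
rewrite (@tail_energy_sq_cat k (n k).-1 (n k)) ?leq_pred ?leqnn //.
rewrite tail_energy_full addr0.
rewrite -{2}n1 !big_nat1 ler_wpM2r ?invr_ge0 ?sqr_ge0 //.
by apply: sing_val_sq_le; lia.
Qed.

Lemma Gamma_ge0 k : (0 <= Gamma X B k)%E.
Proof. exact: bigmax_ge_id. Qed.

Lemma Gamma_ge r k :
  rank_vector n r -> (storage n r)%:R <= B -> tight n B k r ->
  (\big[Order.min/+oo%E]_(m | m != k) decrement_cost X B k m r
    <= Gamma X B k)%E.
Proof.
move=> rr rB rt.
have rn j : (r j < (n j).+1)%N by case/andP: (rr j).
(* The maximum runs over finite functions, so [r] is repackaged as one. *)
pose rho : {dffun forall j, 'I_(n j).+1} := [ffun j => Ordinal (rn j)].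
have rhoE : (fun j => rho j : nat) = r by apply/funext => j; rewrite ffunE.
rewrite /Gamma.
have := @le_bigmax_cond _ _ _ 0%E rho
  (fun rho : {dffun forall j, 'I_(n j).+1} =>
  [&& [forall j, (1 <= rho j)%N], (storage n (fun j => rho j))%:R <= B
        & tight n B k (fun j => rho j)])
  (fun rho => \big[Order.min/+oo%E]_(m | m != k)
      decrement_cost X B k m (fun j => rho j)).
rewrite rhoE; apply; rewrite rB rt !andbT.
by apply/forallP => j; rewrite ffunE; case/andP: (rr j).
Qed.

Lemma certified_full_rank r j : is_minimiser X B r -> certified X B j ->
  r j = n j.
Proof.
move=> [rr rB rmin] [_ cert]; apply/eqP; case/andP: (rr j) => rj1.
rewrite leq_eqVlt => /orP[//|rjn]; exfalso.
have step := tail_energy_step rjn.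
have last_gt0 : 0 < tail_energy X j (n j).-1 ^+ 2.
  by rewrite -lte_fin; apply: le_lt_trans (Gamma_ge0 j) cert.
(* If the slack covers the increment, mode [j] is raised alone and the surrogate drops; otherwise
   [r] is tight. *)
have [sD|sD] := lerP (increment n j r)%:R (slack n B r).
  pose r' := upd r j (r j).+1.
  have rr' : rank_vector n r'.
    by move=> k; rewrite /r' /upd; case: eqP => [->|_] //; rewrite rjn.
  have rB' : (storage n r')%:R <= B.
    by rewrite storage_increment natrD addrC -lerBrDr.
  have := rmin _ rr' rB'.
  rewrite /surrogate !(bigD1 j (P := predT)) //= /r' upd_same.
  have -> : \sum_(k | k != j) tail_energy X k (upd r j (r j).+1 k) ^+ 2 =
      \sum_(k | k != j) tail_energy X k (r k) ^+ 2.
    by apply: eq_bigr => k kj; rewrite upd_other.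
  rewrite lerD2r; lra.
have rt : tight n B j r by rewrite /tight rjn sD subr_ge0 rB.
have := le_lt_trans (Gamma_ge rr rB rt) cert.
(* A minimum below a finite value is reached at some mode [m] of finite cost, hence [p < r m] and
   the lowered rank stays positive. *)
case/bigmin_ltP => [//|[m mj]]; rewrite /decrement_cost.
set p := decrement n B j m r; case: ifP => // pm; rewrite lte_fin => cost.
pose r' := upd (upd r j (r j).+1) m (r m - p).
have r'm : r' m = (r m - p)%N by rewrite /r' upd_same.
have r'j : r' j = (r j).+1 by rewrite /r' upd_other 1?eq_sym // upd_same.
have r'k k : k != j -> k != m -> r' k = r k.
  by move=> kj km; rewrite /r' !upd_other.
have /andP[rm1 rmn] := rr m.
have rr' : rank_vector n r'.
  move=> k; have [->|km] := eqVneq k m.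
    by rewrite r'm subn_gt0 pm (leq_trans (leq_subr _ _)).
  by have [->|kj] := eqVneq k j; [rewrite r'j rjn | rewrite r'k ?rr].
have rB' : (storage n r')%:R <= B.
  have := storage_exchange mj (ltnW pm); rewrite -/r'.
  set D := (n m + _)%N; move: (storage n r') => S' SE.
  have {SE} : (S' + p * D)%:R = (storage n r + increment n j r)%:R :> R.
    by rewrite SE.
  have D0 : (0 : R) < D%:R by rewrite ltr0n /D addn_gt0 (leq_trans rm1 rmn).
  (* Rounding up makes [p * D] cover the missing storage. *)
  have : ((increment n j r)%:R - slack n B r) / D%:R <= p%:R.
    rewrite /p /decrement -/D; set x := _ / _.
    have x0 : 0 < x by rewrite divr_gt0 // subr_gt0.
    by rewrite natr_absz gtr0_norm ?ceil_gt0 // ceil_ge.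
  rewrite ler_pdivrMr // /slack.
  move: (storage n r) (increment n j r) => S I.
  by clearbody D; rewrite !natrD natrM; lra.
have := rmin _ rr' rB'.
rewrite /surrogate !(bigD1 j (P := predT)) //=.
rewrite !(bigD1 m (P := fun k => k != j)) //=.
rewrite r'j r'm.
have -> : \sum_(k | (k != j) && (k != m)) tail_energy X k (r' k) ^+ 2 =
    \sum_(k | (k != j) && (k != m)) tail_energy X k (r k) ^+ 2.
  by apply: eq_bigr => k /andP[kj km]; rewrite r'k.
(* The loss in mode [m] is its cost, strictly below the gain in mode [j], against minimality. *)
rewrite (@tail_energy_sq_cat m (r m - p) (r m)) ?leq_subr //; lra.
Qed.

End Allocation.

(** * Relative error at an optimal allocation *)

Unset Implicit Arguments.
Set Strict Implicit.

Theorem corollary5p2 (R : realType) (d : nat) (n : 'I_d -> nat)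
    (X : tensor R n) (B : R) (rstar : 'I_d -> nat) (C : {set 'I_d})
    (Xhat Y : tensor R n) (k : 'I_d) :
  (2 <= d)%N ->
  X <> 0 ->
  (exists r, rank_vector n r /\ (storage n r)%:R <= B) ->
  is_minimiser X B rstar ->
  (forall j, j \in C -> certified X B j) ->
  is_hosvd rstar X Xhat \/ is_sthosvd rstar X Xhat ->
  Y = Xhat \/ is_refinement rstar X Xhat Y ->
  k \notin C ->
  0 < tail_energy X k (rstar k) ->
  let e := rel_error X Y in
  let delta := (\sum_(j | (j \notin C) && (j != k))
                  tail_energy X j (rstar j) ^+ 2)
               / tail_energy X k (rstar k) ^+ 2 in
  (tail_energy X k (rstar k) <= e /\
   e <= tail_energy X k (rstar k) * Num.sqrt (1 + delta)) /\
  ((forall j, j != k -> j \in C) ->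
   e ^+ 2 = surrogate X rstar /\
   surrogate X rstar = tail_energy X k (rstar k) ^+ 2).
Proof.
move=> d2 X0 feas rmin cert approx refine kC Lk0 e delta.
have [rr _ _] := rmin; have rn j : (rstar j <= n j)%N by case/andP: (rr j).
have LC j : j \in C -> tail_energy X j (rstar j) ^+ 2 = 0.
  by move=> jC; rewrite (certified_full_rank rmin (cert _ jC)) tail_energy_full.
have surrE : surrogate X rstar =
    (\sum_j sq_tail (unfold j X) (rstar j)) / frobenius X ^+ 2.
  by rewrite mulr_suml; apply: eq_bigr => j _; rewrite tail_energy_sq.
have hat_le : frobenius (X - Xhat) ^+ 2 <=
    \sum_j sq_tail (unfold j X) (rstar j).
  by case: approx => [/(hosvd_error_le rn)|/(sthosvd_error_le rn)].
have Y_le : frobenius (X - Y) ^+ 2 <= \sum_j sq_tail (unfold j X) (rstar j).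
  case: refine => [->//|[_ YX]]; apply: le_trans hat_le.
  by rewrite lerXn2r ?nnegrE ?sqrtr_ge0.
have Y_ge : sq_tail (unfold k X) (rstar k) <= frobenius (X - Y) ^+ 2.
  case: refine => [->|[tY _]]; last exact: tucker_error_ge.
  (* An ST-HOSVD output is a Tucker tensor by its very form. *)
  case: approx => [hY|[s [U [G [_ _ YE]]]]]; first exact: hosvd_error_ge.
  by apply: tucker_error_ge => //; exists G, U.
have F0 : 0 <= (frobenius X ^+ 2)^-1 by rewrite invr_ge0 sqr_ge0.
have eE : e ^+ 2 = frobenius (X - Y) ^+ 2 / frobenius X ^+ 2.
  by rewrite /e /rel_error exprMn exprVn.
have e0 : 0 <= e by rewrite divr_ge0 ?sqrtr_ge0.
have e_ge : tail_energy X k (rstar k) ^+ 2 <= e ^+ 2.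
  by rewrite eE tail_energy_sq ler_wpM2r.
have e_le : e ^+ 2 <= surrogate X rstar by rewrite eE surrE ler_wpM2r.
(* Certified modes have full rank and empty tails; what remains beside mode [k] is the numerator of
   [delta]. *)
have surrk : surrogate X rstar = tail_energy X k (rstar k) ^+ 2 +
    \sum_(j | (j \notin C) && (j != k)) tail_energy X j (rstar j) ^+ 2.
  rewrite /surrogate (bigD1 k) //=; congr (_ + _).
  rewrite (bigID (mem C)) /= big1 ?add0r => [|j /andP[_ /LC//]].
  by apply: eq_bigl => j; rewrite andbC.
split; last first.
  move=> allC; have sk : surrogate X rstar = tail_energy X k (rstar k) ^+ 2.
    rewrite surrk big1 ?addr0 // => j /andP[jC jk].
    by rewrite (allC _ jk) in jC.
  by split=> //; apply/eqP; rewrite eq_le e_le sk e_ge.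
have delta0 : 0 <= delta.
  by rewrite divr_ge0 ?sqr_ge0 // sumr_ge0 // => j _; rewrite sqr_ge0.
(* Both bounds are compared after squaring; the square of the upper one is the surrogate. *)
clearbody e; split; first by rewrite -(@ler_pXn2r _ 2) ?nnegrE // ltW.
rewrite -(@ler_pXn2r _ 2) ?nnegrE ?mulr_ge0 ?sqrtr_ge0 ?(ltW Lk0) //.
have sE : Num.sqrt (1 + delta) ^+ 2 = 1 + delta by rewrite sqr_sqrtr ?addr_ge0.
rewrite exprMn sE mulrDr mulr1 /delta [X in _ + X]mulrC divfK.
  by rewrite -surrk.
by rewrite expf_neq0 // gt_eqF.
Qed.
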